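(* Let $N\ge 1$, let $d_0,d_1,\dots,d_N$ be positive integers, and for each $n\in\{1,\dots,N\}$ let $\boldsymbol{W}_n\in\mathbb{R}^{d_n\times d_{n-1}}$, $\boldsymbol{b}_n\in\mathbb{R}^{d_n}$, and $\sigma_{n,i}:\mathbb{R}\to\mathbb{R}$ ($i=1,\dots,d_n$) be given, with $\boldsymbol{\sigma}_n(\boldsymbol{x}):=[\sigma_{n,1}(x_1),\dots,\sigma_{n,d_n}(x_{d_n})]^{\mathsf T}$ for $\boldsymbol{x}\in\mathbb{R}^{d_n}$. Let $T_n:\mathbb{R}^{d_{n-1}}\to\mathbb{R}^{d_n}$, $T_n(\boldsymbol{x}):=\boldsymbol{\sigma}_n(\boldsymbol{W}_n\boldsymbol{x}+\boldsymbol{b}_n)$, let $T:=T_N\circ T_{N-1}\circ\cdots\circ T_1:\mathbb{R}^{d_0}\to\mathbb{R}^{d_N}$, and write $T(\boldsymbol{x})=[t_1(\boldsymbol{x}),\dots,t_{d_N}(\boldsymbol{x})]^{\mathsf T}$. Let $\psi:=\sum_{i=1}^{d_N}t_i$ and $D:=\nabla\psi:\mathbb{R}^{d_0}\to\mathbb{R}^{d_0}$. Consider the following conditions: (K.1) for every $n\in\{1,\dots,N\}$ and every $i\in\{1,\dots,d_n\}$, $\sigma_{n,i}$ is non-decreasing, differentiable, and convex; (K.2) for every $n\geq 2$, the weight matrix $\boldsymbol{W}_n$ is (entrywise) nonnegative; (L.1) for every $n$ and every $i$, $\sigma_{n,i}$ is Lipschitz continuous; (L.2) for every $n$, the functions $\sigma_{n,i}$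 are differentiable and the operator $\boldsymbol{\sigma}_n':\mathbb{R}^{d_n}\to\mathbb{R}^{d_n}$, $\boldsymbol{\sigma}'_n(\boldsymbol{x}):=[\sigma_{n,1}'(x_1),\dots,\sigma_{n,d_n}'(x_{d_n})]^{\mathsf T}$, is Lipschitz continuous. Then: (a) If (K.1) and (K.2) hold, then $t_i$ is a differentiable convex function for every $i\in\{1,\dots,d_N\}$. (b) If (L.1) and (L.2) hold, then $D$ is Lipschitz continuous. (c) If (K.1), (K.2), (L.1), and (L.2) hold, then $D$ is a MoL-Grad denoiser; that is, if $L_D>1$ is a Lipschitz constant of $D$, then $D=\text{s-Prox}_{\varphi}$ for some $(1-L_D^{-1})$-weakly convex function $\varphi:\mathbb{R}^{d_0}\to(-\infty,+\infty]$.
   Context: Norms are Euclidean. An operator $F$ is Lipschitz continuous if there is $\kappa>0$ (a Lipschitz constant of $F$) with $\|F(\boldsymbol{x})-F(\boldsymbol{y})\|\le\kappa\|\boldsymbol{x}-\boldsymbol{y}\|$ for all $\boldsymbol{x},\boldsymbol{y}$. For $\rho>0$, a function $f$ is $\rho$-weakly convex if $f+(\rho/2)\|\cdot\|^2$ is convex. Single-valued proximity operator: for a proper function $f:\mathbb{R}^m\to(-\infty,+\infty]$, $\text{s-Prox}_{f}:\mathbb{R}^m\to\mathbb{R}^m$ is defined by $\text{s-Prox}_f(\boldsymbol{x}):=\operatorname{argmin}_{\boldsymbol{y}\in\mathbb{R}^m}\big(f(\boldsymbol{y})+\tfrac12\|\boldsymbol{x}-\boldsymbol{y}\|^2\big)$,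 whenever $f+\tfrac12\|\boldsymbol{x}-\cdot\|^2$ has a unique minimizer for every $\boldsymbol{x}\in\mathbb{R}^m$. An operator $D:\mathbb{R}^m\to\mathbb{R}^m$ is a MoL-Grad (monotone Lipschitz-gradient) denoiser if, for some $\beta\in(0,1)$, (i) $D$ is $\beta^{-1}$-Lipschitz continuous and (ii) $D=\nabla\psi$ for a Fréchet differentiable convex function $\psi:\mathbb{R}^m\to\mathbb{R}$. A known fact (which may be used) is that for every $\beta\in(0,1)$, conditions (i) and (ii) hold jointly if and only if $D=\text{s-Prox}_{\varphi}$ for some $\varphi:\mathbb{R}^m\to(-\infty,\infty]$ such that $\varphi+[(1-\beta)/2]\|\cdot\|^2$ is proper, lower semicontinuous and convex, and in that case $\varphi=\psi^*-\tfrac12\|\cdot\|^2$, where $\psi^*(\boldsymbol{z}):=\sup_{\boldsymbol{x}}(\langle\boldsymbol{x},\boldsymbol{z}\rangle-\psi(\boldsymbol{x}))$ is the Fenchel conjugate. *)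

(* Defs.v *)
From mathcomp Require Export all_boot all_order all_algebra.
From mathcomp Require Export all_classical all_reals all_analysis.
Export numFieldNormedType.Exports.
Export Order.TTheory GRing.Theory Num.Theory.

Set Implicit Arguments.
Unset Strict Implicit.
Unset Printing Implicit Defensive.

Local Open Scope classical_set_scope.
Local Open Scope ring_scope.

(* The library norm on 'cV[R]_m is the sup norm, hence this explicit one.
   Both induce the same topology, so [differentiable] is Fréchet
   differentiability for either. *)
Definition enorm (R : realType) (m : nat) (x : 'cV[R]_m) : R :=
  Num.sqrt (\sum_i x i 0 ^+ 2).

Definition lipschitz_const (R : realType) (m p : nat)
    (k : R) (F : 'cV[R]_m -> 'cV[R]_p) : Prop :=
  0 < k /\ forall x y, enorm (F x - F y) <= k * enorm (x - y).

Definition lipschitz_op (R : realType) (m p : nat)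
    (F : 'cV[R]_m -> 'cV[R]_p) : Prop :=
  exists k : R, lipschitz_const k F.

(* The Riesz representative of the Fréchet derivative 'd f x; meaningful only
   where f is differentiable. *)
Definition gradient (R : realType) (m : nat) (f : 'cV[R]_m -> R)
    (x : 'cV[R]_m) : 'cV[R]_m :=
  \col_i 'd f x (delta_mx i 0).

Definition diff_convex (R : realType) (m : nat) (f : 'cV[R]_m -> R) : Prop :=
  (forall x, differentiable f x) /\
  convex_function [set: convex_lmodType 'cV[R]_m] f.

Definition MoL_Grad (R : realType) (m : nat)
    (D : 'cV[R]_m -> 'cV[R]_m) : Prop :=
  exists beta : R, [/\ 0 < beta < 1,
    lipschitz_const beta^-1 D &
    exists2 psi : 'cV[R]_m -> R, diff_convex psi & D = gradient psi].

Definition proper_fun (R : realType) (m : nat)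
    (f : 'cV[R]_m -> \bar R) : Prop :=
  (forall x, f x != -oo%E) /\ exists x, f x != +oo%E.

(* Intended for f > -oo; 0 * +oo = 0 makes the cases t = 0, 1 trivial. *)
Definition econvex (R : realType) (m : nat) (f : 'cV[R]_m -> \bar R) : Prop :=
  forall (x y : 'cV[R]_m) (t : R), 0 <= t <= 1 ->
    (f (t *: x + (1 - t) *: y)%R <= t%:E * f x + (1 - t)%:E * f y)%E.

Definition weakly_convex (R : realType) (m : nat)
    (rho : R) (f : 'cV[R]_m -> \bar R) : Prop :=
  econvex (fun x => (f x + (rho / 2 * enorm x ^+ 2)%:E)%E).

Definition argmin (R : realType) (m : nat) (g : 'cV[R]_m -> \bar R) :
    set 'cV[R]_m :=
  [set y | forall z, (g y <= g z)%E].

(* "D = s-Prox_f": s-Prox_f is only defined when every argmin is a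
   singleton. *)
Definition is_sProx (R : realType) (m : nat)
    (f : 'cV[R]_m -> \bar R) (D : 'cV[R]_m -> 'cV[R]_m) : Prop :=
  proper_fun f /\
  forall x, argmin (fun y => (f y + (2^-1 * enorm (x - y) ^+ 2)%:E)%E)
            = [set D x].

Definition cwise (R : realType) (m : nat) (s : 'I_m -> R -> R)
    (x : 'cV[R]_m) : 'cV[R]_m :=
  \col_i s i (x i 0).

Definition layer (R : realType) (p m : nat) (W : 'M[R]_(m, p)) (b : 'cV[R]_m)
    (s : 'I_m -> R -> R) (x : 'cV[R]_p) : 'cV[R]_m :=
  cwise s (W *m x + b).

(* Layers are numbered from 0: W n, b n, s n are W_(n+1), b_(n+1),
   sigma_(n+1), and [net W b s N] is T_N \o ... \o T_1. Only the data of
   index n < N are used by an N-layer network. *)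
Fixpoint net (R : realType) (d : nat -> nat)
    (W : forall n, 'M[R]_(d n.+1, d n)) (b : forall n, 'cV[R]_(d n.+1))
    (s : forall n, 'I_(d n.+1) -> R -> R) (N : nat) :
    'cV[R]_(d 0%N) -> 'cV[R]_(d N) :=
  match N with
  | 0%N => fun x => x
  | n.+1 => fun x => layer (W n) (b n) (s n) (net W b s n x)
  end.

Definition net_sum (R : realType) (d : nat -> nat)
    (W : forall n, 'M[R]_(d n.+1, d n)) (b : forall n, 'cV[R]_(d n.+1))
    (s : forall n, 'I_(d n.+1) -> R -> R) (N : nat) (x : 'cV[R]_(d 0%N)) : R :=
  \sum_(i < d N) net W b s N x i 0.

Definition cond_K1 (R : realType) (d : nat -> nat)
    (s : forall n, 'I_(d n.+1) -> R -> R) (N : nat) : Prop :=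
  forall n, (n < N)%N -> forall i : 'I_(d n.+1),
    [/\ {homo s n i : x y / x <= y},
        forall x, derivable (s n i) x 1 &
        convex_function [set: convex_lmodType R^o] (s n i)].

Definition cond_K2 (R : realType) (d : nat -> nat)
    (W : forall n, 'M[R]_(d n.+1, d n)) (N : nat) : Prop :=
  forall n, (0 < n < N)%N -> forall i j, 0 <= W n i j.

Definition cond_L1 (R : realType) (d : nat -> nat)
    (s : forall n, 'I_(d n.+1) -> R -> R) (N : nat) : Prop :=
  forall n, (n < N)%N -> forall i : 'I_(d n.+1),
    exists2 k : R, 0 < k & k.-lipschitz (s n i).

Definition cond_L2 (R : realType) (d : nat -> nat)
    (s : forall n, 'I_(d n.+1) -> R -> R) (N : nat) : Prop :=
  forall n, (n < N)%N ->
    (forall (i : 'I_(d n.+1)) x, derivable (s n i) x 1) /\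
    lipschitz_op (cwise (fun i => derive1 (s n i))).

(* Main.v *)
From HB Require Import structures.
Require Import Defs.
From mathcomp Require Import ring lra.

(** Parts (a) and (b) go by induction over the layers: convexity of the
    coordinates survives nonnegative combinations and nondecreasing convex
    activations, and the class of Lipschitz functions whose partial derivatives
    are bounded and Lipschitz is closed under affine combinations and under
    activations of the same kind.  For (c), take phi = psi^* - |.|^2 / 2.
    The proximal objective at x is then psi^*(y) - <x, y> up to a constant, and
    its minimizers are the subgradients of psi at x, of which the gradient is
    the only one.  The descent lemma for psi makes psi^* strongly convex with
    modulus 1 / L, which is the weak convexity of phi. *)

Set Implicit Arguments.
Unset Strict Implicit.
Unset Printing Implicit Defensive.

Local Open Scope classical_set_scope.
Local Open Scope ring_scope.

(** * Inner product and Euclidean norm *)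

Section EuclideanSpace.
Context {R : realType} {m : nat}.
Implicit Types u v w x y z : 'cV[R]_m.

Definition dot u v : R := \sum_i u i 0 * v i 0.

Lemma dotC u v : dot u v = dot v u.
Proof. by apply: eq_bigr => i _; rewrite mulrC. Qed.

Lemma dotDl u v w : dot (u + v) w = dot u w + dot v w.
Proof. by rewrite -big_split; apply: eq_bigr => i _; rewrite mxE mulrDl. Qed.

Lemma dotZl a u v : dot (a *: u) v = a * dot u v.
Proof. by rewrite mulr_sumr; apply: eq_bigr => i _; rewrite mxE mulrA. Qed.

Lemma dotDr u v w : dot u (v + w) = dot u v + dot u w.
Proof. by rewrite dotC dotDl !(dotC u). Qed.

Lemma dotZr a u v : dot u (a *: v) = a * dot u v.
Proof. by rewrite dotC dotZl dotC. Qed.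

Lemma dotBl u v w : dot (u - v) w = dot u w - dot v w.
Proof. by rewrite dotDl -scaleN1r dotZl mulN1r. Qed.

Lemma dotBr u v w : dot u (v - w) = dot u v - dot u w.
Proof. by rewrite dotC dotBl !(dotC u). Qed.

Definition dotE := (dotBl, dotBr, dotDl, dotDr, dotZl, dotZr).

Lemma dot_ge0 u : 0 <= dot u u.
Proof. by apply: sumr_ge0 => i _; rewrite -expr2 sqr_ge0. Qed.

Lemma dot_eq0 u : dot u u = 0 -> u = 0.
Proof.
move=> /eqP; rewrite psumr_eq0 => [/allP u0|i _]; last
  by rewrite -expr2 sqr_ge0.
apply/colP => i; rewrite mxE.
by have /(_ (mem_index_enum i)) := u0 i; rewrite -expr2 sqrf_eq0 => /eqP.
Qed.

Lemma enorm_ge0 x : 0 <= enorm x.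
Proof. exact: sqrtr_ge0. Qed.

Lemma enorm_sqr x : enorm x ^+ 2 = dot x x.
Proof. by rewrite sqr_sqrtr ?sumr_ge0 // => i _; rewrite sqr_ge0. Qed.

(** Cauchy-Schwarz. The squared norm of |v|u - |u|v expands to 2|u||v|(|u||v| - <u,v>), and the
    factor |u||v| can be divided out once both norms are nonzero. *)
Lemma dot_le_enorm u v : dot u v <= enorm u * enorm v.
Proof.
have [v0|v0] := eqVneq (enorm v) 0.
  have -> : v = 0 by apply: dot_eq0; rewrite -enorm_sqr v0 expr0n.
  by rewrite -(scale0r 0) dotZr mul0r mulr_ge0 // enorm_ge0.
have [u0|u0] := eqVneq (enorm u) 0.
  have -> : u = 0 by apply: dot_eq0; rewrite -enorm_sqr u0 expr0n.
  by rewrite -(scale0r 0) dotZl mul0r mulr_ge0 // enorm_ge0.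
have p : 0 < enorm u * enorm v.
  by rewrite mulr_gt0 // lt_neqAle eq_sym enorm_ge0 andbT.
have := dot_ge0 (enorm v *: u - enorm u *: v).
rewrite !dotE -!enorm_sqr (dotC v u) => h.
have : 0 <= (enorm u * enorm v) * (enorm u * enorm v - dot u v) by lra.
by rewrite pmulr_rge0 // subr_ge0.
Qed.

Lemma enormZ a x : 0 <= a -> enorm (a *: x) = a * enorm x.
Proof.
move=> a0; apply/eqP; rewrite -(@eqrXn2 _ 2) ?mulr_ge0 ?enorm_ge0 //.
by rewrite exprMn !enorm_sqr dotZl dotZr mulrA.
Qed.

Lemma coord_le_enorm x i : `|x i 0| <= enorm x.
Proof.
rewrite -(@ler_pXn2r _ 2) ?nnegrE ?enorm_ge0 // enorm_sqr.
rewrite real_normK ?num_real //.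
rewrite /dot (bigD1 i) //= -expr2 lerDl sumr_ge0 // => j _.
by rewrite -expr2 sqr_ge0.
Qed.

Lemma enorm_le_coord (K : 'I_m -> R) x (r : R) : 0 <= r ->
  (forall i, `|x i 0| <= K i * r) -> enorm x <= Num.sqrt (\sum_i K i ^+ 2) * r.
Proof.
move=> r0 xK.
rewrite -(@ler_pXn2r _ 2) ?nnegrE ?mulr_ge0 ?enorm_ge0 ?sqrtr_ge0 //.
rewrite exprMn enorm_sqr sqr_sqrtr ?sumr_ge0 //; last
  by move=> i _; exact: sqr_ge0.
rewrite mulr_suml; apply: ler_sum => i _.
rewrite -expr2 -exprMn -[leLHS]real_normK ?num_real //.
by rewrite ler_pXn2r ?nnegrE ?(le_trans _ (xK i)).
Qed.

End EuclideanSpace.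

(** * One-sided derivatives and derivatives along lines *)

Section Derivatives.
Context {R : realType}.

(** The derivative is a limit of right difference quotients, all nonnegative here. This first-order
    condition yields the tangent inequality, the uniqueness of subgradients and the bound on the
    derivative of a Lipschitz function. *)
Lemma is_derive_ge0 (g : R -> R) (c : R) :
  is_derive (0 : R) (1 : R) g c ->
  (forall t, 0 < t < 1 -> g 0 <= g t) -> 0 <= c.
Proof.
move=> [gd <-] gmin; rewrite /derive cvg_at_rightE; last exact: gd.
apply: limr_ge.
  (* The right-hand limit exists because right neighbourhoods of 0 refine punctured ones. *)
  rewrite -(cvg_at_rightE (fun h : R => h^-1 *: ((g \o shift 0) _ - g 0))) //.
  apply: cvg_trans gd; apply: cvg_app.
  by move=> A [e egt0 Ae]; exists e => // x xe xgt0; apply: Ae => //;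
    exact/lt0r_neq0.
near=> h; rewrite /= [_%:A]mulr1 addr0; apply: mulr_ge0.
  by rewrite invr_ge0; apply: ltW; near: h; exact: nbhs_right_gt.
rewrite subr_ge0; apply: gmin; apply/andP; split; near: h.
  exact: nbhs_right_gt.
exact: nbhs_right_lt.
Unshelve. all: by end_near. Qed.

Lemma diff_dot m (f : 'cV[R]_m -> R) (x w : 'cV[R]_m) :
  'd f x w = dot (gradient f x) w.
Proof.
have {1}-> : w = \sum_i w i 0 *: delta_mx i 0.
  apply/colP => i; rewrite summxE (bigD1 i) //= big1 => [|j ji].
    by rewrite !mxE !eqxx mulr1 addr0.
  by rewrite !mxE eq_sym (negPf ji) mulr0.
rewrite linear_sum; apply: eq_bigr => i _.
by rewrite linearZ mxE mulrC.
Qed.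

Lemma is_derive_line m (f : 'cV[R]_m -> R) (x w : 'cV[R]_m) (t : R) :
  differentiable f (x + t *: w) ->
  is_derive t (1 : R) (fun t => f (x + t *: w))
    (dot (gradient f (x + t *: w)) w).
Proof.
move=> df.
have dl : is_diff t (fun t : R => x + t *: w) (fun t : R => t *: w).
  have := @is_diffD _ _ _ _ _ _ _ _ (is_diff_cst x t) (is_diff_scalel t w).
  by rewrite add0r.
have dlt : differentiable (fun t : R => x + t *: w) t by case: dl.
have dfl : differentiable (f \o (fun t : R => x + t *: w)) t.
  exact: differentiable_comp.
apply: DeriveDef; first exact/derivable1_diffP.
rewrite deriveE // diff_comp //= [X in 'd f _ X](_ : _ = w) ?diff_dot //.
by case: dl => _ ->; rewrite scale1r.
Qed.

End Derivatives.

(** * First-order properties of convex and smooth functions *)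

Section Convexity.
Context {R : realType}.

Lemma convexE (E : lmodType R) (f : E -> R) :
  convex_function [set: convex_lmodType E] f <->
  forall x y t, 0 <= t <= 1 ->
    f (t *: x + (1 - t) *: y) <= t * f x + (1 - t) * f y.
Proof.
split=> [fc x y t /andP[t0 t1]|fc t x y _ _].
  by apply: (fc (Itv01 t0 t1)); rewrite inE.
by apply: fc; rewrite ge0 le1.
Qed.

(** The free coefficients let one formula serve the auxiliary functions of the next three lemmas. *)
Lemma is_derive_line_quad m (f : 'cV[R]_m -> R) (x w : 'cV[R]_m) (k a b t : R) :
  differentiable f (x + t *: w) ->
  is_derive t (1 : R) (fun t => k * f (x + t *: w) + t * a + t ^+ 2 * b)
    (k * dot (gradient f (x + t *: w)) w + a + 2 * t * b).
Proof.
move=> df; have H1 := is_deriveZ k (is_derive_line df).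
have H2 := is_deriveZ a (is_derive_id t (1 : R)).
have H3 := is_deriveZ b (is_deriveX 2 (is_derive_id t (1 : R))).
rewrite (_ : (fun _ => _) =
    k *: (fun t => f (x + t *: w)) + a *: id + b *: (id ^+ 2)).
  apply: (is_derive_eq (is_deriveD (is_deriveD H1 H2) H3)).
  by rewrite /GRing.scale /=; ring.
by apply/funext => u; rewrite !fctE /GRing.scale /=; ring.
Qed.

Context {m : nat}.
Implicit Types (f : 'cV[R]_m -> R) (x y z : 'cV[R]_m).

Lemma convex_ge_tangent f x z : diff_convex f ->
  f x + dot (gradient f x) (z - x) <= f z.
Proof.
move=> [df /convexE cf].
have dl := df (x + 0 *: (z - x)).
(* Up to a constant this is the chord from x to z minus f. Convexity makes it smallest at t = 0, and
   its slope there is f z - f x - <grad f x, z - x>. *)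
have h := is_derive_ge0 (is_derive_line_quad (-1) (f z - f x) 0 dl).
rewrite scale0r addr0 in h.
suff H : forall t : R, 0 < t < 1 ->
  -1 * f x + 0 * (f z - f x) + 0 ^+ 2 * 0 <=
  -1 * f (x + t *: (z - x)) + t * (f z - f x) + t ^+ 2 * 0.
  by have := h H; lra.
move=> t /andP[t0 t1]; have : 0 <= t <= 1 by rewrite !ltW.
move=> /(cf z x); have -> : t *: z + (1 - t) *: x = x + t *: (z - x).
  by rewrite scalerBl scale1r scalerBr addrCA.
lra.
Qed.

Lemma subgradient_eq f x y : differentiable f x ->
  (forall z, f x + dot y (z - x) <= f z) -> y = gradient f x.
Proof.
(* Along w, the function f(x + t w) - t <y, w> is smallest at t = 0, where its slope is -|w|^2;
   hence w = 0. *)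
move=> df hy; pose w := y - gradient f x.
have dl : differentiable f (x + 0 *: w) by rewrite scale0r addr0.
have h := is_derive_ge0 (is_derive_line_quad 1 (- dot y w) 0 dl).
rewrite scale0r addr0 in h.
have H : forall t : R, 0 < t < 1 ->
  1 * f x + 0 * - dot y w + 0 ^+ 2 * 0 <=
  1 * f (x + t *: w) + t * - dot y w + t ^+ 2 * 0.
  by move=> t _; have := hy (x + t *: w); rewrite addrAC subrr add0r dotZr; lra.
have w0 : dot w w <= 0 by have := h H; rewrite {2}/w dotBl; lra.
apply/eqP; rewrite -subr_eq0; apply/eqP/dot_eq0/eqP.
by rewrite eq_le w0 dot_ge0.
Qed.

Lemma descent_lemma f (L : R) x (h : 'cV[R]_m) :
  (forall x, differentiable f x) ->
  lipschitz_const L (gradient f) ->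
  f (x + h) <= f x + dot (gradient f x) h + L / 2 * dot h h.
Proof.
move=> df [_ lf].
(* With these coefficients the auxiliary function is f(x + t h) minus the claimed bound, up to the
   constant f x. By Cauchy-Schwarz and the Lipschitz gradient its derivative is nonpositive for t >=
   0. *)
pose a := - dot (gradient f x) h; pose b := - (L / 2 * dot h h).
have dg (t : R) := is_derive_line_quad 1 a b (df (x + t *: h)).
have [|t t01] := MVT (@ltr01 R) (fun t _ => dg t).
  by apply: derivable_within_continuous => t _; case: (dg t).
rewrite scale0r scale1r addr0 => e.
have t0 : 0 <= t by move: t01; rewrite in_itv /= => /andP[/ltW].
have := le_trans (dot_le_enorm _ _)
  (ler_wpM2r (enorm_ge0 h) (lf (x + t *: h) x)).
rewrite [x + _ - _]addrC addKr enormZ // dotBl.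
rewrite (_ : L * (t * enorm h) * _ = L * t * enorm h ^+ 2); last by ring.
rewrite enorm_sqr; move: e; rewrite /a /b.
(* Over variables, since [lra] would compare the matrix expressions up to
   conversion, which diverges. *)
have aux (f1 f0 d1 d0 q : R) :
    1 * f1 + 1 * - d0 + 1 ^+ 2 * - (L / 2 * q) -
      (1 * f0 + 0 * - d0 + 0 ^+ 2 * - (L / 2 * q)) =
    (1 * d1 - d0 + 2 * t * - (L / 2 * q)) * (1 - 0) ->
    d1 - d0 <= L * t * q -> f1 <= f0 + d0 + L / 2 * q.
  by move: {+}L {+}t => *; lra.
exact: aux.
Qed.

End Convexity.

(** * Fenchel conjugate and the associated penalty *)

Section Conjugate.
Context {R : realType} {m : nat}.
Implicit Types (psi : 'cV[R]_m -> R) (x y z : 'cV[R]_m).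

Definition conjugate psi z : \bar R :=
  ereal_sup (range (fun x => (dot x z - psi x)%:E)).

Lemma conjugate_ge psi x z : ((dot x z - psi x)%:E <= conjugate psi z)%E.
Proof. by apply: ereal_sup_ubound; exists x. Qed.

Lemma conjugate_le psi z (c : R) :
  (conjugate psi z <= c%:E)%E <-> forall x, dot x z - psi x <= c.
Proof.
split=> [h x|h]; first by rewrite -lee_fin (le_trans (conjugate_ge _ _ _) h).
by apply: ge_ereal_sup => _ [x _ <-]; rewrite lee_fin.
Qed.

(** Equality case of Fenchel-Young: by the tangent inequality the supremum is attained at x. *)
Lemma conjugate_gradient psi x : diff_convex psi ->
  conjugate psi (gradient psi x) = (dot x (gradient psi x) - psi x)%:E.
Proof.
move=> cpsi; apply/eqP; rewrite eq_le conjugate_ge andbT.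
apply/conjugate_le => z.
have := convex_ge_tangent x z cpsi; rewrite dotBr !(dotC (gradient psi x)); lra.
Qed.

Lemma conjugate_cases psi z :
  conjugate psi z = +oo%E \/ exists a : R, conjugate psi z = a%:E.
Proof.
have := conjugate_ge psi 0 z.
by case: (conjugate psi z) => [a _|_|//]; [right; exists a|left].
Qed.

(* Testing psi^* at u and v with the points x + (1 - t) / L (u - v) and
   x - t / L (u - v) makes the gradient terms of the descent lemma cancel. *)
Lemma conjugate_strongly_convex psi (L : R) u v (t a b : R) :
  (forall x, differentiable psi x) -> lipschitz_const L (gradient psi) ->
  0 <= t <= 1 -> conjugate psi u = a%:E -> conjugate psi v = b%:E ->
  (conjugate psi (t *: u + (1 - t) *: v) <=
   (t * a + (1 - t) * b - t * (1 - t) * (L^-1 / 2) * dot (u - v) (u - v))%:E)%E.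
Proof.
move=> dpsi lpsi /andP[t0 t1] ea eb; apply/conjugate_le => x.
have L0 : 0 < L by case: lpsi.
(* [w] is kept opaque so that the expansion of [dot] does not split u - v. *)
have [w wE] : exists w, w = u - v by exists (u - v).
pose s := L^-1; rewrite -wE.
have Ls : L * s = 1 by rewrite mulfV // gt_eqF.
have /conjugate_le/(_ (x + ((1 - t) * s) *: w)) hu :
    (conjugate psi u <= a%:E)%E.
  by rewrite ea.
have /conjugate_le/(_ (x + (- t * s) *: w)) hv : (conjugate psi v <= b%:E)%E.
  by rewrite eb.
have du := descent_lemma x (((1 - t) * s) *: w) dpsi lpsi.
have dv := descent_lemma x ((- t * s) *: w) dpsi lpsi.
have s1 : 0 <= 1 - t by rewrite subr_ge0.
have := lerD (ler_wpM2l t0 (lerD hu du)) (ler_wpM2l s1 (lerD hv dv)).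
have : dot w u - dot w v = dot w w by rewrite -dotBr -wE.
rewrite !dotDl !dotZl !dotZr !dotDr !dotZr -/s.
have aux (q wu wv xu xv p1 p2 p0 g : R) : wu - wv = q ->
    t * (xu + (1 - t) * s * wu - p1 + p1) +
      (1 - t) * (xv + - t * s * wv - p2 + p2) <=
    t * (a + (p0 + (1 - t) * s * g +
        L / 2 * ((1 - t) * s * ((1 - t) * s * q)))) +
      (1 - t) * (b + (p0 + - t * s * g + L / 2 * (- t * s * (- t * s * q)))) ->
    t * xu + (1 - t) * xv - p0 <=
    t * a + (1 - t) * b - t * (1 - t) * (s / 2) * q.
  move=> <-.
  (* Regrouping exposes the factor L * s = 1; what remains is linear in its monomials. *)
  rewrite (_ : L / 2 * _ =
    (L * s) / 2 * ((1 - t) * (1 - t) * s * (wu - wv))); last by ring.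
  rewrite (_ : L / 2 * _ = (L * s) / 2 * (t * t * s * (wu - wv))); last by ring.
  by rewrite Ls; lra.
exact: aux.
Qed.

Definition mol_penalty psi z : \bar R :=
  (conjugate psi z - (2^-1 * dot z z)%:E)%E.

Lemma mol_penalty_weakly_convex psi (L : R) :
  (forall x, differentiable psi x) -> lipschitz_const L (gradient psi) ->
  weakly_convex (1 - L^-1) (mol_penalty psi).
Proof.
move=> dpsi lpsi u v t /andP[t0 t1].
have E z : (mol_penalty psi z + ((1 - L^-1) / 2 * enorm z ^+ 2)%:E)%E =
   (conjugate psi z - (L^-1 / 2 * dot z z)%:E)%E.
  rewrite /mol_penalty enorm_sqr -addeA -EFinN -EFinD -EFinN.
  congr (_ + _%:E)%E; lra.
rewrite !E.
(* The endpoints come first because a zero weight absorbs an infinite value. For 0 < t < 1, an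
   infinite conjugate at u or v makes the right-hand side infinite. *)
have [->|tn0] := eqVneq t 0.
  by rewrite scale0r add0r subr0 scale1r mul0e add0e mul1e.
have [->|tn1] := eqVneq t 1.
  by rewrite scale1r subrr scale0r addr0 mul0e adde0 mul1e.
have {}t0 : 0 < t by rewrite lt_neqAle eq_sym tn0.
have {}t1 : 0 < 1 - t by rewrite subr_gt0 lt_neqAle tn1.
have [eu|[a ea]] := conjugate_cases psi u.
  have [ev|[b eb]] := conjugate_cases psi v.
    by rewrite eu ev /= !gt0_muley ?lte_fin // leey.
  by rewrite eu eb /= gt0_muley ?lte_fin // leey.
have [ev|[b eb]] := conjugate_cases psi v.
  by rewrite ea ev /= gt0_muley ?lte_fin // leey.
have t01 : 0 <= t <= 1 by apply/andP; lra.
have := conjugate_strongly_convex dpsi lpsi t01 ea eb.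
rewrite ea eb -!EFinN -!EFinD => h.
apply: le_trans (leeD2r _ h) _; rewrite -EFinD lee_fin.
(* This rests on t|u|^2 + (1 - t)|v|^2 - |tu + (1 - t)v|^2 = t(1 - t)|u - v|^2. *)
rewrite !dotE (dotC v u); lra.
Qed.

Lemma mol_penalty_sProx psi : diff_convex psi ->
  is_sProx (mol_penalty psi) (gradient psi).
Proof.
move=> cpsi; have dpsi x : differentiable psi x by case: cpsi.
have E x y : (mol_penalty psi y + (2^-1 * enorm (x - y) ^+ 2)%:E)%E =
   (conjugate psi y + (2^-1 * dot x x - dot x y)%:E)%E.
  rewrite /mol_penalty enorm_sqr -addeA -EFinN -EFinD; congr (_ + _%:E)%E.
  rewrite !dotE (dotC y x); lra.
split.
  split=> [x|]; rewrite /mol_penalty.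
    by case: (conjugate_cases psi x) => [|[a]] ->.
  by exists (gradient psi 0); rewrite conjugate_gradient.
move=> x; apply/seteqP; split=> [y /= hy|_ -> z]; rewrite ?E.
(* Comparing the minimizer y with the gradient bounds the conjugate at y by <x, y> - psi x, which
   unfolds to the subgradient inequality at x. *)
- apply: subgradient_eq => // z; have := hy (gradient psi x).
  rewrite !E conjugate_gradient // -EFinD => h.
  have /conjugate_le/(_ z) : (conjugate psi y <= (dot x y - psi x)%:E)%E.
    move: h; case: (conjugate_cases psi y) => [|[a]] -> //.
    by rewrite -EFinD !lee_fin; lra.
  rewrite dotBr !(dotC y); lra.
(* Fenchel-Young at x bounds the objective below by its value at the gradient. *)
- rewrite conjugate_gradient // -EFinD.
  apply: le_trans (leeD2r _ (conjugate_ge psi x z)).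
  rewrite -EFinD lee_fin; lra.
Qed.

End Conjugate.

(** * Closure properties of differentiable convex functions *)

Section DiffConvex.
Context {R : realType} {m : nat}.
Implicit Types (f g : 'cV[R]_m -> R).

Lemma diff_convex_sum n (f : 'I_n -> 'cV[R]_m -> R) :
  (forall j, diff_convex (f j)) -> diff_convex (fun x => \sum_j f j x).
Proof.
move=> df; split=> [x|].
  by rewrite -fct_sumE; apply: differentiable_sum => j; case: (df j).
apply/convexE => x y t t01; rewrite !mulr_sumr -big_split /=.
by apply: ler_sum => j _; have [_ /convexE] := df j; apply.
Qed.

Lemma diff_convexZ (c : R) f : 0 <= c -> diff_convex f ->
  diff_convex (fun x => c * f x).
Proof.
move=> c0 [df /convexE cf]; split=> [x|].
  exact: (@differentiableZ _ _ _ f c x).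
apply/convexE => x y t t01.
by rewrite [t * _]mulrCA [(1 - t) * _]mulrCA -mulrDr ler_wpM2l // cf.
Qed.

Lemma diff_convexDcst (c : R) f :
  diff_convex f -> diff_convex (fun x => f x + c).
Proof.
move=> [df /convexE cf]; split=> [x|].
  exact: (@differentiableD _ _ _ f (cst c) x).
by apply/convexE => x y t t01; have := cf x y t t01; lra.
Qed.

(** Serves the first layer, whose weights may have either sign. *)
Lemma diff_convex_linear (c : 'I_m -> R) :
  diff_convex (fun x : 'cV[R]_m => \sum_j c j * x j 0).
Proof.
apply: diff_convex_sum => j; split=> [x|].
  apply: (@differentiableZ _ _ _ (fun x : 'cV[R]_m => x j 0) (c j) x).
  exact: differentiable_coord.
by apply/convexE => x y t _; rewrite !mxE; lra.
Qed.

Lemma diff_convex_comp (sg : R -> R) f :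
  {homo sg : x y / x <= y} -> (forall x, derivable sg x 1) ->
  convex_function [set: convex_lmodType R^o] sg ->
  diff_convex f -> diff_convex (fun x => sg (f x)).
Proof.
move=> sgm sgd /convexE sgc [df /convexE cf]; split=> [x|].
  by apply: (@differentiable_comp _ _ _ _ f sg x) => //; exact/derivable1_diffP.
apply/convexE => x y t t01.
exact: le_trans (sgm _ _ (cf x y t t01)) (sgc _ _ _ t01).
Qed.

End DiffConvex.

(** * Functions with bounded Lipschitz partial derivatives *)

Section Smooth.
Context {R : realType}.

Lemma derive1_lipschitz_bound (sg : R -> R) (k x : R) :
  derivable sg x 1 -> (forall x y, `|sg x - sg y| <= k * `|x - y|) ->
  `|derive1 sg x| <= k.
Proof.
move=> dsg lsg.
(* For either sign e, the map t -> k t + e sg(x + t) is, for t > 0, at least its value at 0, so its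
   slope k + e sg'(x) is nonnegative. *)
suff H (e : R) : `|e| = 1 -> 0 <= k + e * derive1 sg x.
  have := H 1 (normr1 _); have := H (-1) (normrN1 _).
  by rewrite ler_norml => ? ?; apply/andP; lra.
move=> e1.
have Dx : is_derive (0 + x : R) (1 : R) sg (derive1 sg x).
  by rewrite add0r derive1E; exact: derivableP.
have Ds := is_derive_shift (0 : R) (1 : R) x.
have H1 := is_deriveZ e (@is_derive1_comp _ sg (shift x) _ _ _ Dx Ds).
have H2 := is_deriveZ k (is_derive_id (0 : R) (1 : R)).
have := is_derive_ge0 (is_deriveD H2 H1).
rewrite /GRing.scale /= !mulr1; apply => t /andP[t0 _].
change (k * 0 + e * sg (0 + x) <= k * t + e * sg (t + x)).
rewrite mulr0 !add0r -lerBlDr -mulrBr.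
apply: le_trans (ler_norm _) _; rewrite normrM e1 mul1r distrC.
by apply: le_trans (lsg _ _) _; rewrite addrK gtr0_norm.
Qed.

Context {m : nat}.
Implicit Types (f g : 'cV[R]_m -> R).

Definition globally_bounded f := exists K : R, forall x, `|f x| <= K.

Definition elipschitz f :=
  exists2 K : R, 0 <= K & forall x y, `|f x - f y| <= K * enorm (x - y).

Lemma elipschitzD f g : elipschitz f -> elipschitz g ->
  elipschitz (fun x => f x + g x).
Proof.
move=> [K K0 fK] [L L0 gL]; exists (K + L); first exact: addr_ge0.
move=> x y; rewrite opprD addrACA mulrDl.
by apply: le_trans (ler_normD _ _) (lerD _ _).
Qed.

Lemma elipschitzM f g : globally_bounded f -> globally_bounded g ->
  elipschitz f -> elipschitz g -> elipschitz (fun x => f x * g x).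
Proof.
move=> [B fB] [C gC] [K K0 fK] [L L0 gL].
have B0 : 0 <= B by apply: le_trans (fB 0).
have C0 : 0 <= C by apply: le_trans (gC 0).
exists (B * L + K * C); first by rewrite addr_ge0 ?mulr_ge0.
move=> x y; rewrite (_ : _ - _ = f x * (g x - g y) + (f x - f y) * g y);
  last by ring.
apply: le_trans (ler_normD _ _) _.
set r := enorm (x - y).
rewrite (_ : _ * r = B * (L * r) + K * r * C); last by ring.
by apply: lerD; rewrite normrM; apply: ler_pM.
Qed.

Lemma bounded_cst (c : R) : globally_bounded (cst c).
Proof. by exists `|c|. Qed.

Lemma elipschitz_cst (c : R) : elipschitz (cst c).
Proof. by exists 0 => // x y; rewrite subrr normr0 mul0r. Qed.

Lemma boundedD f g : globally_bounded f -> globally_bounded g ->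
  globally_bounded (fun x => f x + g x).
Proof.
move=> [B fB] [C gC]; exists (B + C) => x.
exact: le_trans (ler_normD _ _) (lerD _ _).
Qed.

Lemma boundedM f g : globally_bounded f -> globally_bounded g ->
  globally_bounded (fun x => f x * g x).
Proof. by move=> [B fB] [C gC]; exists (B * C) => x; rewrite normrM ler_pM. Qed.

Lemma elipschitz_comp (sg : R -> R) f (k : R) :
  0 <= k -> (forall x y, `|sg x - sg y| <= k * `|x - y|) ->
  elipschitz f -> elipschitz (fun x => sg (f x)).
Proof.
move=> k0 sgk [K K0 fK]; exists (k * K); first exact: mulr_ge0.
by move=> x y; apply: le_trans (sgk _ _) _; rewrite -mulrA ler_wpM2l.
Qed.

(** Made to survive the chain rule: a product of Lipschitz functions is Lipschitz when both factors
    are bounded, and f itself must be Lipschitz for sg' o f to be so. *)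
Definition smooth f := [/\ forall x, differentiable f x, elipschitz f &
  forall i, globally_bounded (fun x => gradient f x i 0) /\
            elipschitz (fun x => gradient f x i 0)].

Lemma smoothD f g : smooth f -> smooth g -> smooth (f + g).
Proof.
move=> [df lf Gf] [dg lg Gg]; split=> [x||i].
- exact: differentiableD.
- exact: elipschitzD.
- have [[bf Lf] [bg Lg]] := (Gf i, Gg i).
  have -> : (fun x => gradient (f + g) x i 0) =
      (fun x => gradient f x i 0 + gradient g x i 0).
    by apply/funext => x; rewrite !mxE diffD.
  by split; [exact: boundedD|exact: elipschitzD].
Qed.

Lemma smooth_cst (c : R) : smooth (cst c).
Proof.
split=> [x||i]; [by []|exact: elipschitz_cst|].
have -> : (fun x => gradient (cst c) x i 0) = cst 0.
  by apply/funext => x; rewrite !mxE diff_cst.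
by split; [exact: bounded_cst|exact: elipschitz_cst].
Qed.

Lemma smooth_coord j : smooth (fun x : 'cV[R]_m => x j 0).
Proof.
(* Packed as a linear map, the coordinate is its own differential, so its gradient is constant. *)
have lin : linear (fun x : 'cV[R]_m => x j 0) by move=> a x y; rewrite !mxE.
pose lM := GRing.isLinear.Build _ _ _ _ _ lin.
pose L : {linear 'cV[R]_m -> R} := HB.pack (fun x : 'cV[R]_m => x j 0) lM.
split=> [x||i]; first exact: differentiable_coord.
  by exists 1 => // x y; rewrite mul1r
    (le_trans _ (coord_le_enorm _ j)) // !mxE.
have -> : (fun x => gradient (fun x : 'cV[R]_m => x j 0) x i 0) =
    cst (delta_mx i (0 : 'I_1) j 0).
  apply/funext => x; rewrite mxE.
  by rewrite (@diff_lin _ _ _ L) //; exact: coord_continuous.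
by split; [exact: bounded_cst|exact: elipschitz_cst].
Qed.

Lemma smooth_sum n (f : 'I_n -> 'cV[R]_m -> R) :
  (forall j, smooth (f j)) -> smooth (fun x => \sum_j f j x).
Proof.
move=> sf; have -> : (fun x => \sum_j f j x) = \sum_j f j.
  by apply/funext => x; rewrite fct_sumE.
apply: (big_ind _ (smooth_cst 0) smoothD) => j _; exact: sf.
Qed.

Lemma smooth_comp (sg : R -> R) f (k l : R) :
  (forall x, derivable sg x 1) ->
  (forall x y, `|sg x - sg y| <= k * `|x - y|) ->
  (forall x y, `|derive1 sg x - derive1 sg y| <= l * `|x - y|) ->
  smooth f -> smooth (fun x => sg (f x)).
Proof.
move=> dsg sgk sgl [df lf Gf].
have bd x : `|derive1 sg x| <= k by exact: derive1_lipschitz_bound.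
have k0 : 0 <= k := le_trans (normr_ge0 _) (bd 0).
have l0 : 0 <= l.
  by have := le_trans (normr_ge0 _) (sgl 1 0); rewrite subr0 normr1 mulr1.
have dd x : differentiable sg x by exact/derivable1_diffP.
split=> [x||i].
- exact: (@differentiable_comp _ _ _ _ f sg x).
- exact: (elipschitz_comp k0 sgk lf).
- have [bf Lf] := Gf i.
  have -> : (fun x => gradient (fun x => sg (f x)) x i 0) =
      (fun x => derive1 sg (f x) * gradient f x i 0).
    apply/funext => x; rewrite !mxE (@diff_comp _ _ _ _ f sg x) //=.
    by rewrite deriv1E // mulrC.
  have bsg : globally_bounded (fun x => derive1 sg (f x)) by exists k.
  split; first exact: boundedM.
  by apply: elipschitzM => //; exact: (elipschitz_comp l0 sgl lf).
Qed.

Lemma smoothZ (c : R) f : smooth f -> smooth (fun x => c * f x).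
Proof.
apply: (@smooth_comp ( *%R c) f `|c| 0) => [x|x y|x y].
(* Scaling is treated as an activation; its derivative is constant, whence the Lipschitz constant
   0. *)
- exact: (@derivableZ _ _ _ id c).
- by rewrite -mulrBr normrM.
- rewrite (_ : derive1 (fun x : R => c * x) = cst c).
    by rewrite subrr normr0 mul0r.
  apply/funext => t; rewrite derive1E.
  have := is_deriveZ c (is_derive_id t (1 : R)) => -[_].
  by rewrite /GRing.scale /= mulr1.
Qed.

Lemma smooth_lipschitz_gradient f : smooth f -> lipschitz_op (gradient f).
Proof.
move=> [_ _ Gf].
have /choice[K HK] i : exists K : R, forall x y,
    `|gradient f x i 0 - gradient f y i 0| <= K * enorm (x - y).
  by have [_ [K _ ?]] := Gf i; exists K.
(* The added 1 makes the constant strictly positive. *)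
exists (Num.sqrt (\sum_i K i ^+ 2) + 1); split.
  by rewrite ltr_wpDl ?sqrtr_ge0.
move=> x y; rewrite mulrDl ler_wpDr ?mul1r ?enorm_ge0 //.
apply: enorm_le_coord; first exact: enorm_ge0.
by move=> i; rewrite mxE [(- gradient f y) _ _]mxE; exact: HK.
Qed.

End Smooth.

(** * Induction over the layers *)

Section Network.
Context {R : realType} (d : nat -> nat).
Context (W : forall n, 'M[R]_(d n.+1, d n)) (b : forall n, 'cV[R]_(d n.+1)).
Context (s : forall n, 'I_(d n.+1) -> R -> R).
Local Notation T := (net W b s).

Lemma netSE n x i : T n.+1 x i 0 =
  s i (\sum_j W n i j * T n x j 0 + b n i 0).
Proof. by rewrite /= /layer /cwise !mxE. Qed.

(** The induction starts at the output of the first layer, since nonnegative weights are only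
    assumed from the second layer on. *)
Lemma net_diff_convex N n : cond_K1 s N -> cond_K2 W N -> (n < N)%N ->
  forall i, diff_convex (fun x => T n.+1 x i 0).
Proof.
move=> K1 K2; elim: n => [|n IH] nN i.
all: have [sm sd sc] := K1 _ nN i.
all: rewrite (_ : (fun _ => _) =
    (fun x => s i (\sum_j W _ i j * T _ x j 0 + b _ i 0)));
  last by apply/funext => x; rewrite netSE.
all: apply: diff_convex_comp => //; apply: diff_convexDcst.
  exact: diff_convex_linear.
apply: diff_convex_sum => j; apply: diff_convexZ; first exact: (K2 n.+1).
exact/IH/ltnW.
Qed.

(** Restricts the vector condition to the diagonal, that is, to constant vectors; the square root is
    the norm of the all-ones vector. *)
Lemma cond_L2_coord N n (i : 'I_(d n.+1)) : cond_L2 s N -> (n < N)%N ->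
  exists l : R, forall x y,
    `|derive1 (s i) x - derive1 (s i) y| <= l * `|x - y|.
Proof.
move=> L2 nN; have [_ [k [k0 lk]]] := L2 _ nN.
exists (k * Num.sqrt (\sum_(j < d n.+1) 1 ^+ 2)) => x y.
have := lk (const_mx x) (const_mx y).
move=> /(le_trans (coord_le_enorm _ i)); rewrite !mxE => /le_trans; apply.
rewrite -mulrA ler_wpM2l ?(ltW k0) //.
apply: (@enorm_le_coord _ _ (fun=> 1)) => // j.
by rewrite !mxE mul1r.
Qed.

Lemma net_smooth N n : cond_L1 s N -> cond_L2 s N -> (n <= N)%N ->
  forall i, smooth (fun x => T n x i 0).
Proof.
move=> L1 L2; elim: n => [|n IH] nN i; first exact: smooth_coord.
have [k _ lk] := L1 _ nN i; have [l ll] := cond_L2_coord i L2 nN.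
have [sd _] := L2 _ nN.
rewrite (_ : (fun _ => _) =
  (fun x => s i (\sum_j W n i j * T n x j 0 + b n i 0)));
  last by apply/funext => x; rewrite netSE.
apply: (@smooth_comp _ _ (s i) _ k l) => //.
  by move=> x y; exact: (lk (x, y)).
apply: smoothD (smooth_cst _); apply: smooth_sum => j; apply: smoothZ.
exact/IH/ltnW.
Qed.

End Network.

Theorem theorem1 (R : realType) (N : nat) (d : nat -> nat)
    (W : forall n, 'M[R]_(d n.+1, d n)) (b : forall n, 'cV[R]_(d n.+1))
    (s : forall n, 'I_(d n.+1) -> R -> R)
    (hN : (1 <= N)%N) (hd : forall n, (n <= N)%N -> (0 < d n)%N) :
  let T := net W b s N in
  let psi := net_sum W b s N in
  let D := gradient psi in
  [/\ (* (a) *)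
      cond_K1 s N -> cond_K2 W N ->
      forall i : 'I_(d N), diff_convex (fun x => T x i 0),
      (* (b); the first conjunct says that D is well defined *)
      cond_L1 s N -> cond_L2 s N ->
      (forall x, differentiable psi x) /\ lipschitz_op D
    & (* (c) *)
      cond_K1 s N -> cond_K2 W N -> cond_L1 s N -> cond_L2 s N ->
      MoL_Grad D /\
      forall L : R, 1 < L -> lipschitz_const L D ->
        exists2 phi : 'cV[R]_(d 0%N) -> \bar R,
          weakly_convex (1 - L^-1) phi & is_sProx phi D].
Proof.
move=> T psi D.
have partA : cond_K1 s N -> cond_K2 W N ->
    forall i : 'I_(d N), diff_convex (fun x => T x i 0).
  rewrite /T; case: N hN {hd T psi D} => // n _ K1 K2.
  exact: net_diff_convex K1 K2 (ltnSn n).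
have partB : cond_L1 s N -> cond_L2 s N -> smooth psi.
  by move=> L1 L2; apply: smooth_sum => i; exact: net_smooth L1 L2 (leqnn N) i.
split=> // [L1 L2|K1 K2 L1 L2].
  have spsi := partB L1 L2; split; last exact: smooth_lipschitz_gradient.
  by case: spsi.
have cpsi : diff_convex psi by apply: diff_convex_sum => i; exact: partA.
split; last first.
  move=> L _ lL; exists (mol_penalty psi); last exact: mol_penalty_sProx.
  by apply: mol_penalty_weakly_convex => //; case: cpsi.
have [k [k0 lk]] := smooth_lipschitz_gradient (partB L1 L2).
(* Enlarging the Lipschitz constant k to 1 + k puts its inverse strictly between 0 and 1. *)
exists (1 + k)^-1; split; last by exists psi.
  by rewrite invr_gt0 invf_lt1 ?addr_gt0 // ltrDl k0.
rewrite invrK; split=> [|x y]; first exact: addr_gt0.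
by rewrite mulrDl mul1r (le_trans (lk x y)) // lerDr enorm_ge0.
Qed.
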